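(* For each orthogonal, left-finite TRS, if $s$ strongly $p$-converges to $t$, then there is a reduction of length at most $\omega$ from $s$ strongly $p$-converging to $t$.
   Context: Orthogonal = left-linear and non-overlapping; left-finite = all left-hand sides finite. Partial terms over $\Sigma_\bot=\Sigma\uplus\{\bot\}$ with $s\le_\bot t$ iff $s$ is $t$ with some subterms replaced by $\bot$ form a complete semilattice; $\liminf_{\iota\to\alpha}a_\iota=\bigvee_{\beta<\alpha}\bigwedge_{\beta\le\iota<\alpha}a_\iota$. A reduction $(t_\iota\to_{\pi_\iota}t_{\iota+1})_{\iota<\alpha}$ with contexts $c_\iota$ ($t_\iota$ with position $\pi_\iota$ replaced by $\bot$) strongly $p$-converges to $t$ if $\liminf_{\iota\to\lambda}c_\iota=t_\lambda$ for every limit $\lambda<\alpha$, and $t$ is the last term (closed) or $t=\liminf_{\iota\to\alpha}c_\iota$ (open). *)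

(* Defs.v *)
From Stdlib Require Import List Arith.
Import ListNotations.

(** * Transfinite index sets: an ordinal is represented by a well-ordered type
    (every ordinal is the order type of such a type and conversely). *)
Record wordinal : Type := WOrdinal {
  ocar :> Type;
  olt : ocar -> ocar -> Prop;
  olt_trans : forall a b c, olt a b -> olt b c -> olt a c;
  olt_total : forall a b, olt a b \/ a = b \/ olt b a;
  olt_wf : well_founded olt
}.
Arguments olt {w}.

Definition le_omega (al : wordinal) : Prop :=
  exists f : al -> nat,
    (forall a b, olt a b <-> f a < f b) /\
    (forall a n, n < f a -> exists b, f b = n).

Definition is_succ {al : wordinal} (i k : al) : Prop :=
  olt i k /\ forall m, ~ (olt i m /\ olt m k).
Definition is_max {al : wordinal} (i : al) : Prop := forall k, ~ olt i k.
Definition is_least {al : wordinal} (i : al) : Prop := forall k, ~ olt k i.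
Definition is_limit {al : wordinal} (l : al) : Prop :=
  (exists k, olt k l) /\ ~ (exists k, is_succ k l).

Section Terms.
Context {F V : Type} (ar : F -> nat).

Inductive lab : Type := Fun (f : F) | Var (x : V) | Bot.

(** (possibly infinite) partial terms as labelled trees over positions *)
Definition tree : Type := list nat -> option lab.
Definition pos := list nat.

Definition wf (t : tree) : Prop :=
  t [] <> None /\
  (forall p i, t (p ++ [i]) <> None -> exists f, t p = Some (Fun f) /\ i < ar f) /\
  (forall p f i, t p = Some (Fun f) -> i < ar f -> t (p ++ [i]) <> None).

Definition teq (s t : tree) : Prop := forall p, s p = t p.
Definition total (t : tree) : Prop := forall p, t p <> Some Bot.
Definition finite (t : tree) : Prop :=
  exists n, forall p, t p <> None -> length p <= n.
Definition subtree (t : tree) (p : pos) : tree := fun q => t (p ++ q).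

Definition le_bot (s t : tree) : Prop :=
  forall p l, s p = Some l -> l = Bot \/ t p = Some l.

Fixpoint subst (sg : V -> tree) (l : tree) (q : pos) {struct q} : option lab :=
  match l [] with
  | Some (Var x) => sg x q
  | _ => match q with
         | [] => l []
         | i :: q' => subst sg (fun r => l (i :: r)) q'
         end
  end.

Definition is_prefix (p q : pos) : bool :=
  if list_eq_dec Nat.eq_dec (firstn (length p) q) p then true else false.

Definition repl (t : tree) (p : pos) (u : tree) : tree :=
  fun q => if is_prefix p q then u (skipn (length p) q) else t q.

Definition cxt (t : tree) (p : pos) : tree := repl t p (fun q => match q with [] => Some Bot | _ => None end).

Definition rules := tree -> tree -> Prop.

Definition is_trs (R : rules) : Prop :=
  forall l r, R l r ->
    wf l /\ wf r /\ total l /\ total r /\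
    (forall x, l [] <> Some (Var x)) /\
    (forall p x, r p = Some (Var x) -> exists q, l q = Some (Var x)).

Definition left_finite (R : rules) : Prop := forall l r, R l r -> finite l.

Definition left_linear (R : rules) : Prop :=
  forall l r, R l r -> forall p q x, l p = Some (Var x) -> l q = Some (Var x) -> p = q.

(** no critical pairs: a non-variable position p of l1 such that l1|p and l2
    are unifiable (variables renamed apart), except p = root with the same rule *)
Definition non_overlapping (R : rules) : Prop :=
  forall l1 r1 l2 r2 p, R l1 r1 -> R l2 r2 ->
    (exists f, l1 p = Some (Fun f)) ->
    ~ (p = [] /\ teq l1 l2 /\ teq r1 r2) ->
    ~ (exists s1 s2 : V -> tree,
         (forall x, wf (s1 x)) /\ (forall x, wf (s2 x)) /\
         forall q, subst s1 (subtree l1 p) q = subst s2 l2 q).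

Definition orthogonal (R : rules) : Prop := left_linear R /\ non_overlapping R.

Definition step (R : rules) (t : tree) (p : pos) (t' : tree) : Prop :=
  exists l r (sg : V -> tree), R l r /\ (forall x, wf (sg x)) /\
    t p <> None /\
    (forall q, t (p ++ q) = subst sg l q) /\
    teq t' (repl t p (subst sg r)).

Definition is_glb (P : tree -> Prop) (m : tree) : Prop :=
  wf m /\ (forall u, P u -> le_bot m u) /\
  (forall m', wf m' -> (forall u, P u -> le_bot m' u) -> le_bot m' m).
Definition is_lub (P : tree -> Prop) (m : tree) : Prop :=
  wf m /\ (forall u, P u -> le_bot u m) /\
  (forall m', wf m' -> (forall u, P u -> le_bot u m') -> le_bot m m').

(** t = liminf_{i -> lambda} c_i = sup_{b<lambda} inf_{b<=i<lambda} c_i, where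
    [below i] means i < lambda *)
Definition is_liminf {al : wordinal} (below : al -> Prop) (c : al -> tree) (t : tree) : Prop :=
  exists g : al -> tree,
    (forall b, below b ->
       is_glb (fun u => exists i, below i /\ ~ olt i b /\ u = c i) (g b)) /\
    is_lub (fun u => exists b, below b /\ u = g b) t.

Definition spconv (R : rules) (al : wordinal) (s t : tree) : Prop :=
  exists (T : al -> tree) (P : al -> pos),
    (forall i, wf (T i)) /\ wf t /\
    (forall i, is_least i -> teq (T i) s) /\
    ((al -> False) -> teq t s) /\
    (forall i k, is_succ i k -> step R (T i) (P i) (T k)) /\
    (forall i, is_max i -> step R (T i) (P i) t) /\
    (forall l, is_limit l ->
       is_liminf (fun i => olt i l) (fun i => cxt (T i) (P i)) (T l)) /\
    (inhabited al -> (forall i : al, exists k : al, olt i k) ->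
       is_liminf (fun _ => True) (fun i => cxt (T i) (P i)) t).

End Terms.

(* Main.v *)
Require Import Defs.
From Stdlib Require Import List Arith Lia Classical ClassicalEpsilon FunctionalExtensionality.

(* Let [reach s t] be the coinductive relation: if [t] has a proper root symbol, then [s] has a
   finite reduction to a term with that root symbol whose children reach those of [t]; if the root
   of [t] is [Bot], then [s] is active, i.e. finite reductions from [s] either expose [Bot] at the
   root or perform infinitely many root steps.
   By left-linearity and left-finiteness a redex of [t] can be exposed in [s] by finitely many
   steps, so [reach s] is closed under rewriting of [t]. It is also closed under strong limits: a
   proper symbol of the limit is stable from some stage on, while a [Bot] arising at a position p
   (with no steps above p) is caused either by a stage having [Bot] at p already, or by cofinally
   many steps at p, each of which can be simulated from [s]. Hence strong p-convergence of any
   length implies [reach s t]. Conversely, dovetailing the finite reductions provided by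
   [reach s t], and performing further root steps at every [Bot] of [t] again and again,
   yields a reduction of length at most omega. *)

Import ListNotations.

(** * Trees, contexts and substitutions *)

Section Compression.
Context {F V : Type} (ar : F -> nat).
Local Notation tree := (@tree F V).
Local Notation wf := (@wf F V ar).
Local Notation Bot := (@Bot F V).

Definition prefix (p q : pos) : Prop := exists r, q = p ++ r.

Lemma teq_eq (s t : tree) : teq s t -> s = t.
Proof. intro H; apply functional_extensionality; exact H. Qed.

Lemma subtree_app (t : tree) p q : subtree (subtree t p) q = subtree t (p ++ q).
Proof. apply teq_eq; intro r; unfold subtree; now rewrite app_assoc. Qed.

Lemma is_prefix_spec p q : is_prefix p q = true <-> prefix p q.
Proof.
  unfold is_prefix, prefix; destruct list_eq_dec as [e|ne]; split; intro H; auto.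
  - exists (skipn (length p) q). rewrite <- e at 1. now rewrite firstn_skipn.
  - discriminate.
  - destruct H as [r ->]; exfalso; apply ne.
    now rewrite firstn_app, Nat.sub_diag, firstn_all, app_nil_r.
Qed.

Lemma prefix_dec p q : {prefix p q} + {~ prefix p q}.
Proof.
  destruct (is_prefix p q) eqn:E; [left | right].
  - now apply is_prefix_spec.
  - rewrite <- is_prefix_spec; congruence.
Qed.

Lemma repl_app (t : tree) p u r : repl t p u (p ++ r) = u r.
Proof.
  unfold repl. assert (is_prefix p (p ++ r) = true) as -> by (apply is_prefix_spec; now exists r).
  now rewrite skipn_app, Nat.sub_diag, skipn_all.
Qed.

Lemma repl_at (t : tree) p u : repl t p u p = u [].
Proof. rewrite <- (repl_app t p u []); now rewrite app_nil_r. Qed.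

Lemma repl_out (t : tree) p u q : ~ prefix p q -> repl t p u q = t q.
Proof.
  rewrite <- is_prefix_spec; unfold repl; destruct is_prefix; congruence.
Qed.

Lemma prefix_app_cancel p q r : prefix (p ++ q) (p ++ r) <-> prefix q r.
Proof.
  split; intros [w H]; exists w.
  - rewrite <- app_assoc in H; now apply app_inv_head in H.
  - now rewrite H, app_assoc.
Qed.

Lemma prefix_nil p : prefix [] p.
Proof. now exists p. Qed.

Lemma prefix_comparable p q r : prefix p r -> prefix q r -> prefix p q \/ prefix q p.
Proof.
  revert q r; induction p as [|i p IH]; intros q r Hp Hq; [left; apply prefix_nil|].
  destruct q as [|j q]; [right; apply prefix_nil|].
  destruct Hp as [a ->], Hq as [b Hb]; injection Hb as -> Hb.
  destruct (IH q (p ++ a)) as [[c ->]|[c ->]]; [now exists a|now exists b|left|right]; now exists c.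
Qed.

Lemma repl_sub (t : tree) p u : subtree (repl t p u) p = u.
Proof. apply teq_eq; intro q; apply repl_app. Qed.

Lemma repl_sub_app (t : tree) p q u :
  subtree (repl t (p ++ q) u) p = repl (subtree t p) q u.
Proof.
  apply teq_eq; intro r; unfold subtree.
  destruct (prefix_dec q r) as [[w ->]|H].
  - now rewrite app_assoc, !repl_app.
  - rewrite !repl_out; auto. now rewrite prefix_app_cancel.
Qed.

Lemma repl_sub_disjoint (t : tree) p q u :
  ~ prefix p q -> ~ prefix q p -> subtree (repl t p u) q = subtree t q.
Proof.
  intros H1 H2; apply teq_eq; intro r; apply (repl_out t p u (q ++ r)); intro H3.
  destruct (prefix_comparable p q (q ++ r) H3); auto. now exists r.
Qed.

Lemma repl_repl_sub (t : tree) p q u :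
  repl t p (repl (subtree t p) q u) = repl t (p ++ q) u.
Proof.
  apply teq_eq; intro r.
  destruct (prefix_dec p r) as [[w ->]|H].
  - rewrite repl_app. change (repl t (p ++ q) u (p ++ w)) with (subtree (repl t (p ++ q) u) p w).
    now rewrite repl_sub_app.
  - rewrite !repl_out; auto. intros [w ->]; apply H; exists (q ++ w); now rewrite app_assoc.
Qed.

Lemma repl_repl (t : tree) p u v : repl (repl t p u) p v = repl t p v.
Proof.
  apply teq_eq; intro r.
  destruct (prefix_dec p r) as [[w ->]|H]; [now rewrite !repl_app|now rewrite !repl_out].
Qed.

Lemma repl_self (t : tree) p : repl t p (subtree t p) = t.
Proof.
  apply teq_eq; intro r.
  destruct (prefix_dec p r) as [[w ->]|H]; [now rewrite !repl_app|now rewrite !repl_out].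
Qed.

Lemma repl_nil (t : tree) u : repl t [] u = u.
Proof. exact (repl_sub t [] u). Qed.

Lemma cxt_out (t : tree) p q : ~ prefix p q -> cxt t p q = t q.
Proof. apply repl_out. Qed.

Lemma cxt_in (t : tree) p q l : prefix p q -> cxt t p q = Some l -> l = Bot.
Proof.
  intros [r ->]; unfold cxt; rewrite repl_app; destruct r; congruence.
Qed.

Lemma cxt_at (t : tree) p : cxt t p p = Some Bot.
Proof. apply repl_at. Qed.

Lemma cxt_lab (t : tree) p q l :
  cxt t p q = Some l -> l <> Bot -> ~ prefix p q /\ t q = Some l.
Proof.
  intros H Hl. destruct (prefix_dec p q) as [Hp|Hp].
  - now destruct (Hl (cxt_in _ _ _ _ Hp H)).
  - now rewrite cxt_out in H.
Qed.

(** * Well-formed trees *)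

Lemma wf_iff (t : tree) :
  wf t <-> t [] <> None /\
    forall p i, t (p ++ [i]) <> None <-> exists f, t p = Some (Fun f) /\ i < ar f.
Proof.
  split.
  - intros (H0 & H1 & H2); split; auto. intros p i; split; auto.
    intros (f & Hf & Hi); eauto.
  - intros (H0 & H1); split; [auto|split].
    + intros p i; apply H1.
    + intros p f i Hf Hi; apply H1; eauto.
Qed.

Lemma wf_subtree (t : tree) p : wf t -> t p <> None -> wf (subtree t p).
Proof.
  rewrite !wf_iff; intros [H0 H1] Hp; split.
  - unfold subtree; now rewrite app_nil_r.
  - intros q i; unfold subtree; rewrite app_assoc; apply H1.
Qed.

Lemma wf_inner (t : tree) p i q :
  wf t -> t (p ++ i :: q) <> None -> exists f, t p = Some (Fun f) /\ i < ar f.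
Proof.
  intros Hw; revert p i; induction q as [|j q IH] using rev_ind; intros p i H.
  - now apply Hw.
  - apply IH. replace (p ++ i :: q ++ [j]) with ((p ++ i :: q) ++ [j]) in H
      by now rewrite <- app_assoc.
    apply Hw in H; destruct H as (f & H & _); congruence.
Qed.

Lemma wf_child_defined (t : tree) p f i :
  wf t -> t p = Some (Fun f) -> i < ar f -> t (p ++ [i]) <> None.
Proof. intros (_ & _ & H); apply H. Qed.

Lemma wf_child (t : tree) f i :
  wf t -> t [] = Some (Fun f) -> i < ar f -> wf (subtree t [i]).
Proof.
  intros Hw Hf Hi; apply wf_subtree; auto. exact (wf_child_defined t [] f i Hw Hf Hi).
Qed.

Lemma wf_leaf (t : tree) p q l :
  wf t -> t p = Some l -> (forall f, l <> Fun f) -> t (p ++ q) <> None -> q = [].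
Proof.
  intros Hw Hp Hl Hq; destruct q as [|i q]; auto.
  destruct (wf_inner t p i q Hw Hq) as (f & Hf & _). exfalso; apply (Hl f); congruence.
Qed.

Lemma wf_repl (t : tree) p u : wf t -> t p <> None -> wf u -> wf (repl t p u).
Proof.
  rewrite !wf_iff; intros [H0 H1] Hp [K0 K1]; split.
  - destruct (prefix_dec p []) as [[r Hr]|H]; [|now rewrite repl_out].
    rewrite Hr, repl_app. symmetry in Hr; apply app_eq_nil in Hr; destruct Hr; now subst.
  - intros q i. destruct (prefix_dec p q) as [[r ->]|H].
    + rewrite <- app_assoc, !repl_app. apply K1.
    + rewrite (repl_out t p u q) by auto.
      destruct (prefix_dec p (q ++ [i])) as [[r Hr]|H']; [|now rewrite repl_out].
      destruct r as [|j r _] using rev_ind.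
      * rewrite app_nil_r in Hr. rewrite <- H1, Hr, repl_at; tauto.
      * rewrite app_assoc in Hr; apply app_inj_tail in Hr; destruct Hr as [Hr _].
        exfalso; apply H; now exists r.
Qed.

(** Definedness at [p] is decided by the label of its parent alone, so agreement strictly above [p]
    suffices even when the labels at [p] differ. *)
Lemma wf_position_transfer (s t : tree) p :
  wf s -> wf t -> (forall q i r, p = q ++ i :: r -> s q = t q) -> s p <> None -> t p <> None.
Proof.
  intros Hs Ht H. destruct p as [|i p _] using rev_ind.
  - intros _; apply Ht.
  - apply wf_iff in Hs; apply wf_iff in Ht; destruct Hs as [_ Hs], Ht as [_ Ht].
    rewrite Hs, Ht. now rewrite (H p i []).
Qed.

(** * Substitution and matching *)

Lemma subst_cons sg (l : tree) i q :
  (forall x, l [] <> Some (Var x)) -> subst sg l (i :: q) = subst sg (subtree l [i]) q.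
Proof. intro H; simpl; destruct (l []) as [[f|x|]|]; auto. now destruct (H x). Qed.

Lemma subst_var (sg : V -> tree) (l : tree) x : l [] = Some (Var x) -> subst sg l = sg x.
Proof. intro H; apply teq_eq; intros [|i q]; simpl; now rewrite H. Qed.

Lemma subst_nil (sg : V -> tree) (l : tree) : (forall x, l [] <> Some (Var x)) -> subst sg l [] = l [].
Proof. intro H; simpl; destruct (l []) as [[f|x|]|]; auto. now destruct (H x). Qed.

Lemma subst_child (sg : V -> tree) (l : tree) f i :
  l [] = Some (Fun f) -> subtree (subst sg l) [i] = subst sg (subtree l [i]).
Proof.
  intro H; apply teq_eq; intro q. apply subst_cons; congruence.
Qed.

Lemma wf_subst (sg : V -> tree) (l : tree) : (forall x, wf (sg x)) -> wf l -> wf (subst sg l).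
Proof.
  intros Hsg. rewrite !wf_iff. intros [H0 H1]. split.
  - destruct (l []) as [[f|x|]|] eqn:E; simpl; rewrite E; auto.
    apply (Hsg x).
  - clear H0. intros p i. revert l H1; induction p as [|j p IH]; intros l H1;
      destruct (classic (exists x, l [] = Some (Var x))) as [[x Hx]|Hx].
    1,3: rewrite (subst_var _ _ _ Hx); specialize (Hsg x); rewrite wf_iff in Hsg; apply Hsg.
    + assert (Hn : forall x, l [] <> Some (Var x)) by (intros x Hx'; apply Hx; eauto).
      rewrite (subst_nil _ _ Hn), <- H1. simpl app. rewrite subst_cons by auto.
      simpl. unfold subtree. simpl. destruct (l [i]) as [[f|x|]|]; try tauto.
      split; [discriminate|]. intros _; apply (Hsg x).
    + assert (Hn : forall x, l [] <> Some (Var x)) by (intros x Hx'; apply Hx; eauto).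
      simpl app. rewrite !subst_cons by auto. apply IH.
      intros q k; apply (H1 (j :: q) k).
Qed.

(** Recognises a redex from local data. Induction on the position lets [l] and [s] descend together
    until a variable of [l] is met; outside the arity both sides are undefined. *)
Lemma match_subst (sg : V -> tree) (l s : tree) :
  wf l -> total l -> wf s ->
  (forall q f, l q = Some (Fun f) -> s q = Some (Fun f)) ->
  (forall q x, l q = Some (Var x) -> subtree s q = sg x) ->
  s = subst sg l.
Proof.
  intros Hl Htot Hs HF HV; apply teq_eq; intro q.
  revert l s Hl Htot Hs HF HV; induction q as [|i q IH]; intros l s Hl Htot Hs HF HV;
    destruct (l []) as [[f|x|]|] eqn:E.
  all: try (now destruct Hl); try (now destruct (Htot [])).
  all: try (rewrite (subst_var _ _ _ E), <- (HV [] x E); reflexivity).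
  - simpl; rewrite E; auto.
  - rewrite subst_cons by congruence.
    destruct (Nat.lt_ge_cases i (ar f)) as [Hi|Hi].
    + apply (IH (subtree l [i]) (subtree s [i])).
      * eapply wf_child; eauto.
      * intro p; apply (Htot (i :: p)).
      * eapply wf_child; eauto.
      * intros p g; apply (HF (i :: p)).
      * intros p x Hx. rewrite subtree_app. now apply HV.
    + assert (Hnone : forall t : tree, wf t -> t [] = Some (Fun f) -> forall r, t (i :: r) = None).
      { intros t Ht Htf r; destruct (t (i :: r)) eqn:Er; auto; exfalso.
        destruct (wf_inner t [] i r Ht) as (g & Hg & Hig); [simpl; congruence|].
        assert (f = g) by congruence. subst; lia. }
      rewrite (Hnone s) by auto.
      assert (Hall : forall r, subtree l [i] r = None) by (intro; apply Hnone; auto).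
      revert Hall; generalize (subtree l [i]); clear.
      induction q as [|j q IH]; intros t Ht; simpl; rewrite Ht; auto.
Qed.

(** * Finite reductions and coinductive reachability *)

Section Rewriting.
Local Notation step := (@step F V ar).
Context (R : @rules F V) (trs_R : is_trs ar R).
Context (linear_R : left_linear R) (finite_R : left_finite R).

Lemma step_wf s p t : step R s p t -> wf s -> wf t.
Proof.
  intros (l & r & sg & Hlr & Hsg & Hp & _ & Ht) Hs. apply teq_eq in Ht as ->.
  apply wf_repl; auto. apply wf_subst; auto. now apply (trs_R l r).
Qed.

Lemma step_defined s p t : step R s p t -> s p <> None.
Proof. now intros (l & r & sg & _ & _ & H & _). Qed.

Lemma step_outside s p t q : step R s p t -> ~ prefix p q -> t q = s q.
Proof.
  intros (l & r & sg & _ & _ & _ & _ & Ht) H. apply teq_eq in Ht as ->. now apply repl_out.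
Qed.

Lemma step_disjoint s p t q :
  step R s p t -> ~ prefix p q -> ~ prefix q p -> subtree t q = subtree s q.
Proof.
  intros (l & r & sg & _ & _ & _ & _ & Ht) H1 H2. apply teq_eq in Ht as ->.
  now apply repl_sub_disjoint.
Qed.

Lemma step_subtree s p q t : step R s (p ++ q) t -> step R (subtree s p) q (subtree t p).
Proof.
  intros (l & r & sg & Hlr & Hsg & Hp & Hm & Ht). exists l, r, sg.
  refine (conj Hlr (conj Hsg (conj Hp (conj _ _)))).
  - intro r'. unfold subtree. rewrite app_assoc. apply Hm.
  - apply teq_eq in Ht as ->. rewrite repl_sub_app. intro; reflexivity.
Qed.

Lemma step_context s p q u :
  step R (subtree s p) q u -> step R s (p ++ q) (repl s p u).
Proof.
  intros (l & r & sg & Hlr & Hsg & Hp & Hm & Ht). exists l, r, sg.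
  refine (conj Hlr (conj Hsg (conj Hp (conj _ _)))).
  - intro r'. rewrite <- app_assoc. apply Hm.
  - apply teq_eq in Ht as ->. rewrite repl_repl_sub. intro; reflexivity.
Qed.

(** The contracted positions are recorded because dovetailing must show both that settled labels are
    left alone and that every [Bot] is contracted again and again. *)
Inductive red : tree -> list pos -> tree -> Prop :=
| red_nil s : red s [] s
| red_cons s p s' L t : step R s p s' -> red s' L t -> red s (p :: L) t.

Lemma red_app s L s' L' t : red s L s' -> red s' L' t -> red s (L ++ L') t.
Proof. induction 1; simpl; auto. intro; econstructor; eauto. Qed.

Lemma red_wf s L t : red s L t -> wf s -> wf t.
Proof. induction 1; auto. intro; eauto using step_wf. Qed.

Lemma red_context s p L u :
  red (subtree s p) L u -> red s (map (app p) L) (repl s p u).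
Proof.
  intro H. remember (subtree s p) as s0 eqn:E. revert s E.
  induction H as [s0|s0 q s1 L u Hst Hr IH]; intros s ->.
  - rewrite repl_self. constructor.
  - simpl. econstructor; [apply step_context; eauto|].
    rewrite <- (repl_repl s p s1 u). apply IH. now rewrite repl_sub.
Qed.

(** Steps in different children do not interfere, so the finitely many reductions can be run one
    after another. [Phi] abstracts what the reduction of child [i] achieves; the last clause lets
    claims about positions be lifted to the whole reduction. *)
Lemma red_children (Phi : nat -> list pos -> tree -> Prop) s f :
  wf s -> s [] = Some (Fun f) ->
  (forall i, i < ar f -> exists L u, red (subtree s [i]) L u /\ Phi i L u) ->
  exists L s', red s L s' /\ s' [] = Some (Fun f) /\
    (forall q, In q L -> exists i p, q = i :: p /\ i < ar f) /\
    (forall i, i < ar f -> exists L', Phi i L' (subtree s' [i]) /\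
       forall p, In p L' <-> In (i :: p) L).
Proof.
  intros Hs Hf Hch.
  (* After [k] children have been treated, those from [k] on are still literally children of [s], so
     the hypothesis applies to the next one. *)
  enough (Hk : forall k, k <= ar f ->
    exists L s', red s L s' /\ s' [] = Some (Fun f) /\
    (forall q, In q L -> exists i p, q = i :: p /\ i < k) /\
    (forall i, k <= i -> subtree s' [i] = subtree s [i]) /\
    (forall i, i < k -> exists L', Phi i L' (subtree s' [i]) /\
       forall p, In p L' <-> In (i :: p) L)).
  { destruct (Hk (ar f) (le_n _)) as (L & s' & H1 & H2 & H3 & _ & H4). now exists L, s'. }
  induction k as [|k IH]; intro Hk.
  - exists [], s. repeat split; auto; try constructor; simpl; intros; try tauto; lia.
  - destruct IH as (L & s1 & H1 & H2 & H3 & H4 & H5); [lia|].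
    destruct (Hch k Hk) as (M & u & Hu & HP).
    rewrite <- (H4 k) in Hu by lia. apply red_context in Hu.
    assert (Hdis : forall i, i <> k -> subtree (repl s1 [k] u) [i] = subtree s1 [i]).
    { intros i Hi; apply repl_sub_disjoint; intros [r Hr]; injection Hr; congruence. }
    exists (L ++ map (app [k]) M), (repl s1 [k] u). split; [|split; [|split; [|split]]].
    + eapply red_app; eauto.
    + rewrite repl_out; auto. intros [r Hr]; discriminate.
    + intros q Hq; apply in_app_iff in Hq; destruct Hq as [Hq|Hq].
      * destruct (H3 q Hq) as (i & p & -> & Hi). exists i, p; split; auto; lia.
      * apply in_map_iff in Hq; destruct Hq as (p & <- & _). exists k, p; auto.
    + intros i Hi. rewrite Hdis by lia. apply H4; lia.
    + intros i Hi. destruct (Nat.eq_dec i k) as [->|Hne].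
      * exists M. rewrite repl_sub. split; auto. intro p. rewrite in_app_iff, in_map_iff. split.
        -- intro Hp; right; now exists p.
        -- intros [Hp|(p' & Hp & Hin)].
           ++ destruct (H3 _ Hp) as (i & p' & Heq & Hlt). injection Heq; lia.
           ++ injection Hp as ->; auto.
      * destruct (H5 i) as (L' & HP' & HL'); [lia|]. exists L'. rewrite Hdis by auto.
        split; auto. intro p. rewrite in_app_iff, in_map_iff, HL'. split; auto.
        intros [Hp|(p' & Hp & _)]; auto. injection Hp; congruence.
Qed.

(** * Active terms and the laws of coinductive reachability *)

CoInductive active (s : tree) : Prop :=
| active_bot L s' : red s L s' -> s' [] = Some Bot -> active s
| active_step L s' s'' : red s L s' -> step R s' [] s'' -> active s'' -> active s.

Lemma active_coind (Y : tree -> Prop) :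
  (forall s, Y s -> exists L s', red s L s' /\
     (s' [] = Some Bot \/ exists s'', step R s' [] s'' /\ Y s'')) ->
  forall s, Y s -> active s.
Proof.
  intro HY; cofix CH; intros s Hs.
  destruct (HY s Hs) as (L & s' & Hr & [Hb|(s'' & Hst & Hs'')]).
  - eapply active_bot; eauto.
  - eapply active_step; eauto.
Qed.

Lemma active_red s L s' : red s L s' -> active s' -> active s.
Proof.
  intros Hr [L' s1 Hr' Hb|L' s1 s2 Hr' Hst Ha].
  - eapply active_bot; [eapply red_app; eauto|auto].
  - eapply active_step; [eapply red_app; eauto|eauto|auto].
Qed.

(** Supplies the unit of work that dovetailing repeats at every [Bot] of the target: the activity is
    made visible once and the result is active again. *)
Lemma active_progress s :
  active s -> exists L s', red s L s' /\ active s' /\ (s' [] = Some Bot \/ In [] L).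
Proof.
  intros [L s' Hr Hb|L s' s'' Hr Hst Ha].
  - exists L, s'. repeat split; auto. eapply active_bot; eauto using red_nil.
  - exists (L ++ [[]]), s''. split; [|split; auto].
    + eapply red_app; eauto. econstructor; eauto using red_nil.
    + right. apply in_app_iff; simpl; auto.
Qed.

Record reachF (X : tree -> tree -> Prop) (s t : tree) : Prop := ReachF {
  reach_wf_l : wf s;
  reach_wf_r : wf t;
  reach_bot : t [] = Some Bot -> active s;
  reach_var : forall x, t [] = Some (Var x) -> exists L s', red s L s' /\ s' [] = Some (Var x);
  reach_fun : forall f, t [] = Some (Fun f) ->
    exists L s', red s L s' /\ s' [] = Some (Fun f) /\
      forall i, i < ar f -> X (subtree s' [i]) (subtree t [i])
}.

(* The greatest fixpoint of [reachF]: [s] rewrites in at most omega steps to [t], given by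
   finite reductions that produce [t] layer by layer, with [Bot] standing for an active term. *)
Definition reach (s t : tree) : Prop :=
  exists X : tree -> tree -> Prop, (forall s t, X s t -> reachF X s t) /\ X s t.

Lemma reachF_mono (X Y : tree -> tree -> Prop) s t :
  (forall s t, X s t -> Y s t) -> reachF X s t -> reachF Y s t.
Proof.
  intros HXY [H1 H2 H3 H4 H5]; constructor; auto.
  intros f Hf; destruct (H5 f Hf) as (L & s' & ? & ? & ?); exists L, s'; auto.
Qed.

Lemma reach_unfold s t : reach s t -> reachF reach s t.
Proof.
  intros (X & HX & Hst). apply (reachF_mono X); auto. intros u v Huv; exists X; auto.
Qed.

(** Coinduction up to [reach]: after one layer, a candidate pair may fall back on pairs already
    known to be reachable. *)
Lemma reach_coind (X : tree -> tree -> Prop) :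
  (forall s t, X s t -> reachF (fun s t => X s t \/ reach s t) s t) ->
  forall s t, X s t -> reach s t.
Proof.
  intros HX s t Hst. exists (fun s t => X s t \/ reach s t). split; auto.
  intros u v [H|H]; auto. apply reach_unfold in H. eapply reachF_mono; eauto.
Qed.

Lemma reach_fold s t : reachF reach s t -> reach s t.
Proof.
  intro H. apply (reach_coind (reachF reach)); auto.
  intros u v Huv; eapply reachF_mono; eauto.
Qed.

Lemma reach_refl s : wf s -> reach s s.
Proof.
  intro Hs. apply (reach_coind (fun u v => u = v /\ wf u)); auto.
  intros u v [<- Hu]. constructor; auto.
  - intro H; eapply active_bot; eauto using red_nil.
  - intros x Hx; exists [], u; split; auto using red_nil.
  - intros f Hf; exists [], u; repeat split; auto using red_nil.
    intros i Hi; left; split; auto. eapply wf_child; eauto.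
Qed.

(** Only the reductions that expose the root layer grow: each is prefixed with [L]. *)
Lemma reach_red s L s' t : wf s -> red s L s' -> reach s' t -> reach s t.
Proof.
  intros Hs Hr H. apply reach_unfold in H; destruct H as [H1 H2 H3 H4 H5].
  apply reach_fold; constructor; auto.
  - eauto using active_red.
  - intros x Hx; destruct (H4 x Hx) as (L' & s1 & ? & ?); eauto using red_app.
  - intros f Hf; destruct (H5 f Hf) as (L' & s1 & ? & ? & ?).
    exists (L ++ L'), s1; eauto using red_app.
Qed.

(** The term [r] may be infinite, hence coinduction: the candidate relation walks down [r] without
    any step and falls back on [reach] at a variable. *)
Lemma reach_subst (sg sg' : V -> tree) r :
  (forall x, wf (sg x)) -> (forall x, wf (sg' x)) -> wf r -> total r ->
  (forall p x, r p = Some (Var x) -> reach (sg' x) (sg x)) ->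
  reach (subst sg' r) (subst sg r).
Proof.
  intros Hsg Hsg' Hr Htot Hx.
  apply (reach_coind (fun u v => exists r, wf r /\ total r /\
    (forall p x, r p = Some (Var x) -> reach (sg' x) (sg x)) /\
    u = subst sg' r /\ v = subst sg r)); [|now exists r].
  clear r Hr Htot Hx. intros u v (r & Hr & Htot & Hx & -> & ->).
  destruct (r []) as [[f|x|]|] eqn:E.
  - constructor; auto using wf_subst; rewrite subst_nil by congruence; rewrite E; try discriminate.
    intros g Hg; injection Hg as <-. exists [], (subst sg' r). repeat split; auto using red_nil.
    + rewrite subst_nil; congruence.
    + intros i Hi; left. exists (subtree r [i]). repeat split.
      * eapply wf_child; eauto.
      * eapply wf_child; eauto.
      * eapply wf_child; eauto.
      * intro p; apply (Htot (i :: p)).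
      * intros p x; apply (Hx (i :: p)).
      * now apply (subst_child _ _ f).
      * now apply (subst_child _ _ f).
  - rewrite !(subst_var _ _ _ E). eapply reachF_mono; [|apply reach_unfold; eauto]. auto.
  - now destruct (Htot []).
  - now destruct Hr.
Qed.

(* Only a finite part of [subst sg l] has to be produced, so finitely many steps suffice. *)
Lemma expose_pattern (sg : V -> tree) l n : forall s,
  wf l -> total l -> (forall p, l p <> None -> length p <= n) ->
  reach s (subst sg l) ->
  exists L s', red s L s' /\
    (forall q f, l q = Some (Fun f) -> s' q = Some (Fun f)) /\
    (forall q x, l q = Some (Var x) -> reach (subtree s' q) (sg x)).
Proof.
  revert l; induction n as [|n IH]; intros l s Hl Htot Hn Hre;
    destruct (l []) as [[f|x|]|] eqn:E.
  all: try (now destruct (Htot [])); try (now destruct Hl).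
  all: try (rewrite (subst_var _ _ _ E) in Hre; exists [], s; split; [constructor|];
    split; intros q g Hg;
    assert (q = []) as -> by (apply (wf_leaf l [] q _ Hl E); simpl; congruence);
    [congruence|replace g with x by congruence; exact Hre]).
  all: apply reach_unfold in Hre; destruct Hre as [H1 _ _ _ H5];
    destruct (H5 f) as (L & s1 & Hr & Hs1 & Hch); [rewrite subst_nil; congruence|].
  all: destruct (red_children (fun i _ u =>
      (forall q g, l (i :: q) = Some (Fun g) -> u q = Some (Fun g)) /\
      (forall q x, l (i :: q) = Some (Var x) -> reach (subtree u q) (sg x))) s1 f)
    as (L' & s2 & Hr2 & Hs2 & _ & Hch2); eauto using red_wf.
  - intros i Hi. exfalso. assert (length [i] <= 0); [|simpl in *; lia].
    apply Hn. exact (wf_child_defined l [] f i Hl E Hi).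
  - exists (L ++ L'), s2. split; [eauto using red_app|].
    split; intros [|i q] g Hg; try congruence;
    destruct (wf_inner l [] i q) as (f' & Hf' & Hi); auto; try (simpl; congruence);
    replace f' with f in Hi by congruence; destruct (Hch2 i Hi) as (_ & [A B] & _).
    + now apply A.
    + now apply (B q).
  - intros i Hi. apply (IH (subtree l [i]) (subtree s1 [i])).
    + eapply wf_child; eauto.
    + intro p; apply (Htot (i :: p)).
    + intros p Hp. specialize (Hn (i :: p) Hp); simpl in Hn; lia.
    + rewrite <- (subst_child _ _ f) by auto. auto.
  - exists (L ++ L'), s2. split; [eauto using red_app|].
    split; intros [|i q] g Hg; try congruence;
    destruct (wf_inner l [] i q) as (f' & Hf' & Hi); auto; try (simpl; congruence);
    replace f' with f in Hi by congruence; destruct (Hch2 i Hi) as (_ & [A B] & _).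
    + now apply A.
    + now apply (B q).
Qed.

(** Once the pattern of the redex is exposed in [s], the same rule applies there. Several
    occurrences of one variable could have been exposed to different degrees; left-linearity
    excludes this. *)
Lemma reach_root_step s t t' :
  reach s t -> step R t [] t' ->
  exists L s' s'', red s L s' /\ step R s' [] s'' /\ reach s'' t'.
Proof.
  intros Hre (l & r & sg & Hlr & Hsg & _ & Hm & Ht').
  apply teq_eq in Ht' as ->. rewrite repl_nil.
  assert (t = subst sg l) as -> by (apply teq_eq; exact Hm).
  destruct (trs_R l r Hlr) as (Hl & Hr & Tl & Tr & Hroot & Hvars).
  destruct (finite_R l r Hlr) as [n Hn].
  destruct (expose_pattern sg l n s) as (L & s' & Hs' & HF & HV); auto.
  assert (Ws : wf s) by (now apply reach_unfold in Hre as []).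
  assert (Ws' : wf s') by eauto using red_wf.
  (* The matching substitution reads off the subterm at the occurrence of [x] in [l], unique by
     left-linearity. For other variables [s'] is a well-formed default. *)
  set (sg' := fun x => match excluded_middle_informative (exists q, l q = Some (Var x)) with
                       | left H => subtree s' (proj1_sig (constructive_indefinite_description _ H))
                       | right _ => s'
                       end).
  assert (Hsg' : forall q x, l q = Some (Var x) -> sg' x = subtree s' q).
  { intros q x Hx. unfold sg'. destruct excluded_middle_informative as [H|H].
    - destruct constructive_indefinite_description as [q' Hq']; simpl.
      now rewrite (linear_R l r Hlr q' q x).
    - destruct H; eauto. }
  assert (Wsg' : forall x, wf (sg' x)).
  { intro x. destruct (classic (exists q, l q = Some (Var x))) as [[q Hq]|H].
    - rewrite (Hsg' q x Hq). now apply (HV q x) in Hq; apply reach_unfold in Hq as [].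
    - unfold sg'. destruct excluded_middle_informative; tauto. }
  assert (Es' : s' = subst sg' l).
  { apply match_subst; auto. intros q x Hx; symmetry; auto. }
  exists L, s', (subst sg' r). split; auto. split.
  - exists l, r, sg'. refine (conj Hlr (conj Wsg' (conj _ (conj _ _)))).
    + apply Ws'.
    + intro q; simpl; now rewrite <- Es'.
    + rewrite repl_nil. intro; reflexivity.
  (* Every variable of [r] occurs in [l], so its value in [sg'] is one of the exposed subterms. *)
  - apply reach_subst; auto.
    intros p x Hx. destruct (Hvars p x Hx) as [q Hq]. rewrite (Hsg' q x Hq). eauto.
Qed.

(** A step below the root leaves the root layer intact, so the reduction exposing it is reused and
    the argument moves into one child until the step is at the root. *)
Lemma reach_step s t p t' : reach s t -> step R t p t' -> reach s t'.
Proof.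
  revert s t t'; induction p as [|i p IH]; intros s t t' Hre Hst.
  - assert (Ws : wf s) by (now apply reach_unfold in Hre as []).
    destruct (reach_root_step _ _ _ Hre Hst) as (L & s' & s'' & H1 & H2 & H3).
    apply (reach_red s (L ++ [[]]) s''); auto.
    eapply red_app; eauto. econstructor; eauto using red_nil.
  - apply reach_unfold in Hre; destruct Hre as [H1 H2 _ _ H5].
    destruct (wf_inner t [] i p H2) as (f & Hf & Hi); [now apply step_defined in Hst|].
    destruct (H5 f Hf) as (L & s1 & Hr & Hs1 & Hch).
    assert (Hf' : t' [] = Some (Fun f)).
    { rewrite (step_outside _ _ _ [] Hst); auto. intros [r Hr']; discriminate. }
    apply reach_fold; constructor; auto; try congruence.
    + eauto using step_wf.
    + intros g Hg. replace g with f by congruence. exists L, s1. repeat split; auto.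
      intros j Hj. destruct (Nat.eq_dec j i) as [->|Hne].
      * eapply IH; eauto. apply step_subtree. exact Hst.
      * rewrite (step_disjoint _ _ _ [j] Hst); auto; intros [r Hr']; injection Hr'; congruence.
Qed.

End Rewriting.

(** * Limit inferiors computed pointwise *)

Definition agree (S : tree -> Prop) (p : pos) (l : lab) : Prop :=
  l <> Bot /\ forall u, S u -> u p = Some l.

Definition agree_above (S : tree -> Prop) (p : pos) : Prop :=
  forall q i r, p = q ++ i :: r -> exists f, agree S q (Fun f) /\ i < ar f.

Lemma agree_above_snoc S p i :
  agree_above S (p ++ [i]) <->
  agree_above S p /\ exists f, agree S p (Fun f) /\ i < ar f.
Proof.
  split.
  - intro H; split; [|now apply (H p i [])].
    intros q j r ->. apply (H q j (r ++ [i])). now rewrite <- app_assoc.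
  - intros [H1 H2] q j r Heq. destruct r as [|k r _] using rev_ind.
    + apply app_inj_tail in Heq as [-> ->]; auto.
    + rewrite app_comm_cons, app_assoc in Heq. apply app_inj_tail in Heq as [-> ->]. eauto.
Qed.

(** The explicit infimum of a non-empty set: the part common to all members, followed down from the
    root and cut by [Bot] where no proper label is shared. *)
Definition meet (S : tree -> Prop) : tree := fun p =>
  if excluded_middle_informative (agree_above S p) then
    match excluded_middle_informative (exists l, agree S p l) with
    | left H => Some (proj1_sig (constructive_indefinite_description _ H))
    | right _ => Some Bot
    end
  else None.

Lemma meet_defined S p : meet S p <> None <-> agree_above S p.
Proof.
  unfold meet; destruct excluded_middle_informative; try tauto.
  destruct excluded_middle_informative; split; auto; discriminate.
Qed.

Lemma meet_agree S p l : (exists u, S u) -> l <> Bot ->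
  meet S p = Some l <-> agree_above S p /\ agree S p l.
Proof.
  intros [u Hu] Hl; unfold meet.
  destruct excluded_middle_informative as [H|H]; [|split; [discriminate|tauto]].
  destruct excluded_middle_informative as [H'|H'].
  - destruct constructive_indefinite_description as [l' Hl']; simpl. split.
    + intro E; injection E as ->; auto.
    + intros [_ [_ E]]. destruct Hl' as [_ Hl']. now rewrite <- (E u), <- (Hl' u).
  - split; [congruence|]. intros [_ E]; destruct H'; eauto.
Qed.

Lemma meet_wf S : (exists u, S u) -> wf (meet S).
Proof.
  intro HS; apply wf_iff; split.
  - apply meet_defined. intros q i r H; destruct q; discriminate.
  - intros p i. rewrite meet_defined, agree_above_snoc. split.
    + intros (H & f & Hf & Hi). exists f; split; auto. apply meet_agree; auto; discriminate.
    + intros (f & Hf & Hi). apply meet_agree in Hf as [H1 H2]; eauto; discriminate.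
Qed.

Lemma agree_above_lower S m p :
  wf m -> (forall u, S u -> le_bot m u) -> m p <> None -> agree_above S p.
Proof.
  intros Hm Hle Hp q i r ->. destruct (wf_inner m q i r Hm Hp) as (f & Hf & Hi).
  exists f; split; auto; split; [discriminate|].
  intros u Hu; destruct (Hle u Hu q _ Hf); [discriminate|auto].
Qed.

Lemma agree_lower S m p l :
  (forall u, S u -> le_bot m u) -> m p = Some l -> l <> Bot -> agree S p l.
Proof.
  intros Hle Hp Hl; split; auto. intros u Hu; destruct (Hle u Hu p l Hp); tauto.
Qed.

Lemma meet_glb S : (exists u, S u) -> is_glb ar S (meet S).
Proof.
  intro HS; split; [|split].
  - now apply meet_wf.
  - intros u Hu p l Hp. destruct (classic (l = Bot)) as [|Hl]; auto.
    apply meet_agree in Hp as [_ [_ Hp]]; auto.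
  - intros m Hm Hle p l Hp. destruct (classic (l = Bot)) as [|Hl]; auto.
    right. apply meet_agree; auto. split.
    + eapply agree_above_lower; eauto; congruence.
    + eapply agree_lower; eauto.
Qed.

(** The tree [meet S] is a lower bound, hence below the given infimum [g], and it already carries
    the proper label [l] at [p]. *)
Lemma glb_agree S g p l :
  is_glb ar S g -> (exists u, S u) -> agree_above S p -> agree S p l -> g p = Some l.
Proof.
  intros (_ & _ & Hg) HS Ha Hl. assert (Hb := proj1 Hl).
  destruct (meet_glb S HS) as (M1 & M2 & _).
  destruct (Hg _ M1 M2 p l); try tauto. apply meet_agree; auto.
Qed.

(** * Well-ordered index sets *)

Lemma olt_irrefl (al : wordinal) (a : al) : ~ olt a a.
Proof. induction (olt_wf al a) as [a _ IH]. intro H; now apply (IH a). Qed.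

Lemma lt_not_gt (al : wordinal) (a b : al) : olt a b -> ~ olt b a.
Proof. intros H H'. apply (olt_irrefl al a). eauto using olt_trans. Qed.

Lemma lt_le_trans (al : wordinal) (a b c : al) : olt a b -> ~ olt c b -> olt a c.
Proof.
  intros H1 H2. destruct (olt_total al b c) as [H|[<-|H]]; eauto using olt_trans. tauto.
Qed.

Lemma le_le_trans (al : wordinal) (a b c : al) : ~ olt b a -> ~ olt c b -> ~ olt c a.
Proof. intros H1 H2 H. apply H2. eapply lt_le_trans; eauto. Qed.

Lemma least_witness (al : wordinal) (Q : al -> Prop) :
  (exists a, Q a) -> exists a, Q a /\ forall b, olt b a -> ~ Q b.
Proof.
  intros [a Ha]. induction (olt_wf al a) as [a _ IH].
  destruct (classic (exists b, olt b a /\ Q b)) as [(b & Hb & HQ)|H]; [eauto|].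
  exists a; split; auto. intros b Hb HQ; eauto.
Qed.

Lemma successor (al : wordinal) (i k : al) : olt i k -> exists j, is_succ i j /\ ~ olt k j.
Proof.
  intro H. destruct (least_witness al (fun m => olt i m)) as (j & Hj & Hmin); [eauto|].
  exists j; split; [split; auto|].
  - intros m [H1 H2]. now apply (Hmin m).
  - intro Hk. now apply (Hmin k).
Qed.

(** * Stable labels and the limit inferior of a sequence *)

Section Liminf.
Context (al : wordinal) (below : al -> Prop) (c : al -> tree).

Definition tail (b : al) : tree -> Prop :=
  fun u => exists i, below i /\ ~ olt i b /\ u = c i.

Lemma tail_inhabited b : below b -> exists u, tail b u.
Proof. intro Hb; exists (c b), b; repeat split; auto. apply olt_irrefl. Qed.

Lemma agree_tail b p l :
  agree (tail b) p l <->
  l <> Bot /\ forall i, below i -> ~ olt i b -> c i p = Some l.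
Proof.
  split; intros [H1 H2]; split; auto.
  - intros i Hi Hib. apply H2. now exists i.
  - intros u (i & Hi & Hib & ->); auto.
Qed.

Lemma agree_later b b' p l : ~ olt b' b -> agree (tail b) p l -> agree (tail b') p l.
Proof.
  rewrite !agree_tail; intros Hb [H1 H2]; split; auto.
  intros i Hi Hib; apply H2; auto. eapply le_le_trans; eauto.
Qed.

Lemma agree_above_later b b' p :
  ~ olt b' b -> agree_above (tail b) p -> agree_above (tail b') p.
Proof.
  intros Hb H q i r E. destruct (H q i r E) as (f & Hf & Hi).
  exists f; split; eauto using agree_later.
Qed.

Lemma common_bound b b' :
  below b -> below b' -> exists d, below d /\ ~ olt d b /\ ~ olt d b'.
Proof.
  intros H H'. destruct (olt_total al b b') as [Hlt|[->|Hlt]].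
  - exists b'; repeat split; auto using olt_irrefl, lt_not_gt.
  - exists b'; repeat split; auto using olt_irrefl.
  - exists b; repeat split; auto using olt_irrefl, lt_not_gt.
Qed.

(** There are finitely many positions above [p], each with its own stage of stability, and a common
    later stage serves them all. *)
Lemma eventually_agree_above t p :
  (exists b, below b) -> wf t ->
  (forall p l, t p = Some l -> l <> Bot -> exists b, below b /\ agree (tail b) p l) ->
  t p <> None -> exists b, below b /\ agree_above (tail b) p.
Proof.
  intros [b Hb] Ht Hev. induction p as [|i p IH] using rev_ind; intro Hp.
  - exists b; split; auto. intros q i r H; destruct q; discriminate.
  - apply wf_iff in Ht as Ht'. apply (proj2 Ht') in Hp. destruct Hp as (f & Hf & Hi).
    destruct IH as (b1 & Hb1 & H1); [congruence|].
    destruct (Hev p (Fun f) Hf) as (b2 & Hb2 & H2); [discriminate|].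
    destruct (common_bound b1 b2 Hb1 Hb2) as (d & Hd & Hd1 & Hd2).
    exists d; split; auto. apply agree_above_snoc; split; eauto using agree_above_later, agree_later.
Qed.

Lemma liminf_eventually t p l :
  is_liminf ar below c t -> t p = Some l -> l <> Bot ->
  exists b, below b /\ agree (tail b) p l.
Proof.
  intros (g & Hg & Ht & Hub & Hlub) Hp Hl.
  destruct (classic (exists b, below b /\ g b p = Some l)) as [(b & Hb & Hgb)|H].
  { exists b; split; auto. eapply agree_lower; [apply (Hg b Hb)|eauto|auto]. }
  (* Otherwise cutting [t] at [p] still leaves an upper bound. *)
  exfalso. destruct (Hlub (cxt t p)) with (p := p) (l := l); auto.
  - apply wf_repl; auto; [congruence|]. apply wf_iff; split; [discriminate|].
    intros q i; split; [destruct q; simpl; congruence|].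
    intros (f & Hf & _); destruct q; discriminate.
  - intros u (b & Hb & ->) q l' Hq. destruct (classic (l' = Bot)) as [|Hl']; auto; right.
    assert (Htq : t q = Some l').
    { destruct (Hub (g b)) with (p := q) (l := l'); eauto. tauto. }
    rewrite cxt_out; auto. intros [r ->]. apply H. exists b; split; auto.
    (* A label of [g b] strictly below [p] would force a function symbol of [g b] at [p]; this
       symbol is then the label [l] of [t], which was excluded. *)
    destruct r as [|i r].
    + rewrite app_nil_r in *. congruence.
    + destruct (wf_inner (g b) p i r) as (f & Hf & _); [apply (Hg b Hb)|congruence|].
      destruct (Hub (g b)) with (p := p) (l := @Fun F V f); eauto; congruence.
  - rewrite cxt_at in *. congruence.
Qed.

Lemma liminf_agree t b p l :
  is_liminf ar below c t -> below b -> agree_above (tail b) p -> agree (tail b) p l ->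
  t p = Some l.
Proof.
  intros (g & Hg & Ht & Hub & _) Hb Ha Hl. assert (Hn := proj1 Hl).
  destruct (Hub (g b)) with (p := p) (l := l); eauto; try tauto.
  eapply glb_agree; eauto. now apply tail_inhabited.
Qed.

Lemma liminf_defined t b p :
  is_liminf ar below c t -> below b -> agree_above (tail b) p -> t p <> None.
Proof.
  intros H Hb Ha. assert (Ht : wf t) by (destruct H as (g & _ & Ht & _); auto).
  destruct p as [|i p _] using rev_ind; [apply Ht|].
  apply agree_above_snoc in Ha as (Ha & f & Hf & Hi).
  eapply wf_child_defined; eauto. eapply liminf_agree; eauto.
Qed.

(** The meets of the tails serve as infima. They lie below [t] because their labels cannot clash
    with those of [t]; [t] is least because each of its proper labels shows up in the meet of a late
    enough tail. *)
Lemma liminf_intro t :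
  wf t -> (exists b, below b) ->
  (forall p l, t p = Some l -> l <> Bot -> exists b, below b /\ agree (tail b) p l) ->
  (forall p l b, t p = Some Bot -> below b -> ~ agree (tail b) p l) ->
  is_liminf ar below c t.
Proof.
  intros Ht Hne Hev Hbot. exists (fun b => meet (tail b)).
  assert (Hlab : forall b p l l', below b -> t p = Some l' -> agree (tail b) p l -> l' = l).
  { intros b p l l' Hb Hp Ha. destruct (classic (l' = Bot)) as [->|Hl'].
    - now destruct (Hbot p l b).
    - destruct (Hev p l' Hp Hl') as (b' & Hb' & Ha').
      destruct (common_bound b b' Hb Hb') as (d & Hd & H1 & H2).
      apply (agree_later b d p l H1) in Ha; apply (agree_later b' d p l' H2) in Ha'.
      rewrite agree_tail in Ha, Ha'. destruct Ha as [_ Ha], Ha' as [_ Ha'].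
      specialize (Ha d Hd (olt_irrefl al d)). specialize (Ha' d Hd (olt_irrefl al d)). congruence. }
  assert (Hdef : forall b p, below b -> agree_above (tail b) p -> t p <> None).
  { intros b p Hb. induction p as [|i p IH] using rev_ind; intro Ha; [apply Ht|].
    apply agree_above_snoc in Ha as (Ha & f & Hf & Hi). specialize (IH Ha).
    destruct (t p) as [l'|] eqn:E; [|tauto].
    rewrite (Hlab b p _ l' Hb E Hf) in E. eapply wf_child_defined; eauto. }
  split; [|split; [|split]]; auto.
  - intros b Hb. apply meet_glb. now apply tail_inhabited.
  - intros u (b & Hb & ->) p l Hp. destruct (classic (l = Bot)) as [|Hl]; auto; right.
    apply meet_agree in Hp as [Ha Hp]; auto using tail_inhabited.
    specialize (Hdef b p Hb Ha). destruct (t p) as [l'|] eqn:E; [|tauto].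
    now rewrite (Hlab b p l l' Hb E Hp).
  - intros m Hm Hub p l Hp. destruct (classic (l = Bot)) as [|Hl]; auto.
    destruct (Hev p l Hp Hl) as (b & Hb & Ha).
    destruct (eventually_agree_above t p Hne Ht Hev) as (b' & Hb' & Ha'); [congruence|].
    destruct (common_bound b b' Hb Hb') as (d & Hd & H1 & H2).
    apply (Hub (meet (tail d))); eauto. apply meet_agree; auto using tail_inhabited.
    split; eauto using agree_above_later, agree_later.
Qed.

End Liminf.

(** * Reachability along transfinite reductions *)

Section Chain.
Local Notation step := (@step F V ar).
Context (R : @rules F V) (trs_R : is_trs ar R).
Context (linear_R : left_linear R) (finite_R : left_finite R).
Context (al : wordinal) (T : al -> tree) (P : al -> pos).
Context (T_wf : forall i, wf (T i)).
Context (T_succ : forall i k, is_succ i k -> step R (T i) (P i) (T k)).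
Context (T_limit : forall l, is_limit l ->
  is_liminf ar (fun i => olt i l) (fun i => cxt (T i) (P i)) (T l)).

Lemma ordinal_cases (b g : al) : ~ olt g b ->
  b = g \/ (exists d, is_succ d g /\ ~ olt d b) \/ (is_limit g /\ olt b g).
Proof.
  intro H. destruct (olt_total al b g) as [Hlt|[->|Hlt]]; auto; [right|tauto].
  destruct (classic (exists d, is_succ d g)) as [[d Hd]|Hn]; [left|right].
  - exists d; split; auto. intro Hdb. now apply (proj2 Hd b).
  - split; auto. split; eauto.
Qed.

Definition quiet (b g : al) (p : pos) : Prop :=
  forall i, ~ olt i b -> olt i g -> ~ prefix (P i) p.

(** Unlike [quiet], this tolerates steps at [p] itself: the label there may change, but the position
    survives and its subterm evolves by its own steps. *)
Definition undisturbed (b g : al) (p : pos) : Prop :=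
  forall i, ~ olt i b -> olt i g -> forall j r, p <> P i ++ j :: r.

Lemma quiet_shorter b g p r : quiet b g (p ++ r) -> quiet b g p.
Proof.
  intros H i Hb Hg [w ->]. apply (H i Hb Hg). exists (w ++ r). now rewrite app_assoc.
Qed.

Lemma undisturbed_quiet b g q i r : undisturbed b g (q ++ i :: r) -> quiet b g q.
Proof.
  intros H k Hb Hg [w ->]. destruct w as [|j w].
  - apply (H k Hb Hg i r). now rewrite app_nil_r.
  - apply (H k Hb Hg j (w ++ i :: r)). now rewrite <- app_assoc.
Qed.

Lemma undisturbed_sub b g b' g' p :
  ~ olt b' b -> ~ olt g g' -> undisturbed b g p -> undisturbed b' g' p.
Proof.
  intros Hb Hg H i Hi Hig. apply H; eauto using le_le_trans, lt_le_trans.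
Qed.

(** At a limit, the labels on the path to [p] are constant by induction and not hidden by the
    contexts, so a proper label passes to the limit inferior. If the constant label is [Bot], a
    proper label in the limit would have to occur at some late stage. *)
Lemma quiet_constant g : forall b p,
  ~ olt g b -> quiet b g p -> T b p <> None -> T g p = T b p.
Proof.
  induction (olt_wf al g) as [g _ IH]. intros b p Hbg Hq Hp.
  destruct (ordinal_cases b g Hbg) as [->|[(d & Hd & Hdb)|[Hlim Hlt]]]; auto.
  - rewrite (step_outside R _ _ _ p (T_succ d g Hd)) by (apply Hq; auto; apply Hd).
    apply IH; auto; [apply Hd|]. intros i Hi Hid; apply Hq; auto.
    eapply olt_trans; eauto. apply Hd.
  - assert (Hc : forall q, prefix q p -> forall i, olt i g -> ~ olt i b ->
        cxt (T i) (P i) q = T b q /\ T i q = T b q).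
    { intros q [r ->] i Hi Hib. apply quiet_shorter in Hq.
      rewrite cxt_out by (apply Hq; auto).
      enough (T i q = T b q) by auto. apply IH; auto.
      - intros j Hj Hji; apply Hq; eauto using olt_trans.
      - destruct r as [|k r]; [now rewrite app_nil_r in Hp|].
        destruct (wf_inner (T b) q k r) as (f & Hf & _); auto; congruence. }
    assert (Ha : agree_above (tail al (fun i => olt i g) (fun i => cxt (T i) (P i)) b) p).
    { intros q i r E. rewrite E in Hp.
      destruct (wf_inner (T b) q i r) as (f & Hf & Hi); auto.
      exists f; split; auto. apply agree_tail; split; [discriminate|].
      intros k Hk Hkb. rewrite <- Hf. apply Hc; auto. exists (i :: r); auto. }
    assert (Hpp : prefix p p) by (exists []; now rewrite app_nil_r).
    destruct (T b p) as [l|] eqn:E; [|tauto].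
    destruct (classic (l = Bot)) as [->|Hl].
    + pose proof (liminf_defined _ _ _ _ b p (T_limit g Hlim) Hlt Ha) as Hd.
      destruct (T g p) as [l'|] eqn:E'; [|tauto].
      destruct (classic (l' = Bot)) as [->|Hl']; auto.
      destruct (liminf_eventually _ _ _ _ p l' (T_limit g Hlim) E' Hl') as (b' & Hb' & Hag).
      destruct (common_bound al (fun i => olt i g) b b') as (d & Hd' & H1 & H2); auto.
      apply agree_tail in Hag as [_ Hag]. specialize (Hag d Hd' H2). simpl in Hag.
      destruct (Hc p Hpp d Hd' H1) as [Hc' _]. congruence.
    + apply (liminf_agree _ _ _ _ b p l (T_limit g Hlim)); auto.
      apply agree_tail; split; auto. intros i Hi Hib. rewrite <- E. now apply Hc.
Qed.

Lemma undisturbed_defined b g p :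
  ~ olt g b -> undisturbed b g p -> T b p <> None -> T g p <> None.
Proof.
  intros Hbg Hu Hp. apply (wf_position_transfer (T b)); auto.
  intros q i r E. symmetry. rewrite E in Hu, Hp. apply quiet_constant; auto.
  - eapply undisturbed_quiet; eauto.
  - destruct (wf_inner (T b) q i r) as (f & Hf & _); auto; congruence.
Qed.

(** Transfinite induction on [g], with a coinduction at limits. The position [p] and the starting
    stage [b] are general because the coinduction descends into children, each of which is settled
    from its own stage on. *)
Lemma reach_transport g : forall b p s,
  ~ olt g b -> undisturbed b g p -> T b p <> None ->
  reach R s (subtree (T b) p) -> reach R s (subtree (T g) p).
Proof.
  induction (olt_wf al g) as [g _ IH]. intros b p s Hbg Hu Hp Hs.
  destruct (ordinal_cases b g Hbg) as [->|[(d & Hd & Hdb)|[Hlim Hlt]]]; auto.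
  - assert (Hdg : olt d g) by apply Hd.
    assert (Hs' : reach R s (subtree (T d) p)).
    { apply (IH d Hdg b); auto. apply (undisturbed_sub b g); auto using olt_irrefl, lt_not_gt. }
    pose proof (T_succ d g Hd) as Hst.
    destruct (prefix_dec p (P d)) as [[q Hq]|H1].
    + rewrite Hq in Hst. apply step_subtree in Hst. now apply (reach_step R trs_R linear_R finite_R _ _ q _ Hs').
    + destruct (prefix_dec (P d) p) as [[q Hq]|H2].
      * destruct q as [|j q].
        -- destruct H1. exists []. now rewrite Hq, !app_nil_r.
        -- now destruct (Hu d Hdb Hdg j q).
      * now rewrite (step_disjoint R _ _ _ p Hst).
  (* By the induction hypothesis the starting stage can be moved to any later one below the
     limit. *)
  - assert (Hlater : forall b' b p s, olt b' g -> ~ olt b' b -> undisturbed b g p ->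
      T b p <> None -> reach R s (subtree (T b) p) ->
      undisturbed b' g p /\ T b' p <> None /\ reach R s (subtree (T b') p)).
    { clear b p s Hbg Hu Hp Hs Hlt. intros b' b p s Hb'g Hb'b Hu Hp Hs.
      assert (Hu' : undisturbed b b' p).
      { apply (undisturbed_sub b g); auto using olt_irrefl, lt_not_gt. }
      repeat split; auto.
      - apply (undisturbed_sub b g); auto using olt_irrefl.
      - now apply (undisturbed_defined b b').
      - now apply (IH b' Hb'g b). }
    apply (reach_coind R (fun s u => exists b p, olt b g /\ undisturbed b g p /\
      T b p <> None /\ reach R s (subtree (T b) p) /\ u = subtree (T g) p));
      [|now exists b, p].
    clear b p s Hbg Hu Hp Hs Hlt. intros s u (b & p & Hlt & Hu & Hp & Hs & ->).
    assert (Hbg : ~ olt g b) by auto using lt_not_gt.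
    assert (Hroot : subtree (T g) p [] = T g p) by (unfold subtree; now rewrite app_nil_r).
    (* A proper label of the limit is eventually a label of the contexts. These carry only [Bot] at
       and below the contracted position, so from then on no step is at or above [p]. *)
    assert (Hlab : forall l, T g p = Some l -> l <> Bot -> exists b', olt b' g /\
      undisturbed b' g p /\ quiet b' g p /\ subtree (T b') p [] = Some l /\
      reach R s (subtree (T b') p)).
    { intros l Hl Hn.
      destruct (liminf_eventually _ _ _ _ p l (T_limit g Hlim) Hl Hn) as (b1 & Hb1 & Hag).
      destruct (common_bound al (fun i => olt i g) b b1) as (b' & Hb' & H1 & H2); auto.
      apply agree_tail in Hag as [_ Hag].
      assert (Hq : forall i, ~ olt i b' -> olt i g -> ~ prefix (P i) p /\ T i p = Some l).
      { intros i Hi Hig. apply cxt_lab; auto. apply Hag; auto. eapply le_le_trans; eauto. }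
      destruct (Hlater b' b p s) as (A & B & C); auto.
      exists b'; repeat split; auto.
      - intros i Hi Hig; now apply Hq.
      - unfold subtree; rewrite app_nil_r. apply Hq; auto using olt_irrefl. }
    constructor; try rewrite Hroot.
    + now apply reach_unfold in Hs as [].
    + apply wf_subtree; auto. now apply (undisturbed_defined b g).
    + intro Hbot.
      (* If the steps at [p] cease, the [Bot] was already present at that stage. Otherwise they
         occur cofinally, and each one is simulated by a root step from [s]. *)
      destruct (classic (exists b', olt b' g /\ ~ olt b' b /\ quiet b' g p))
        as [(b' & Hb' & Hb'b & Hq)|Hnq].
      * destruct (Hlater b' b p s) as (A & B & C); auto.
        apply reach_unfold in C as [_ _ C _ _]. apply C.
        unfold subtree; rewrite app_nil_r, <- Hbot. symmetry. apply quiet_constant; auto using lt_not_gt.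
      * apply (active_coind R (fun s => exists b', olt b' g /\ ~ olt b' b /\
          undisturbed b' g p /\ T b' p <> None /\ reach R s (subtree (T b') p)));
          [|exists b; auto using olt_irrefl].
        clear s Hs Hlab. intros s (b1 & Hb1 & Hb1b & Hu1 & Hp1 & Hs1).
        assert (Hi : exists i, ~ olt i b1 /\ olt i g /\ prefix (P i) p).
        { apply NNPP; intro Hn. apply Hnq; exists b1; repeat split; auto.
          intros i Hi Hig Hpre; apply Hn; eauto. }
        destruct Hi as (i & Hib & Hig & [w Hw]).
        destruct w as [|j w]; [|now destruct (Hu1 i Hib Hig j w)].
        rewrite app_nil_r in Hw.
        destruct (Hlater i b1 p s) as (A & B & C); auto.
        (* The simulation resumes at the successor [k] of [i], which stays below [g] because [g] is
           a limit. *)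
        destruct (successor al i g Hig) as (k & Hk & Hkg).
        assert (Hkl : olt k g).
        { destruct (olt_total al k g) as [|[->|]]; auto; [|tauto].
          destruct (proj2 Hlim); eauto. }
        pose proof (T_succ i k Hk) as Hst. rewrite <- Hw, <- (app_nil_r p) in Hst.
        apply step_subtree in Hst.
        destruct (reach_root_step R trs_R linear_R finite_R _ _ _ C Hst)
          as (L & s' & s'' & Hr & Hst' & Hs'').
        exists L, s'; split; auto. right; exists s''; split; auto. exists k.
        assert (Hki : ~ olt k i).
        { intro; apply (olt_irrefl al i). eapply olt_trans; [apply Hk|auto]. }
        repeat split; auto.
        -- eauto using le_le_trans.
        -- apply (undisturbed_sub i g); auto using olt_irrefl.
        -- apply (undisturbed_defined i k); auto.
           apply (undisturbed_sub i g); auto using olt_irrefl.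
    + intros x Hx. destruct (Hlab (Var x) Hx) as (b' & _ & _ & _ & H1 & H2); [discriminate|].
      apply reach_unfold in H2 as [_ _ _ H2 _]. auto.
    + intros f Hf. destruct (Hlab (Fun f) Hf) as (b' & Hb' & Hu' & Hq & H1 & H2); [discriminate|].
      apply reach_unfold in H2 as [_ _ _ _ H2].
      destruct (H2 f H1) as (L & s' & Hr & Hs' & Hch). exists L, s'; repeat split; auto.
      intros i Hi. left. exists b', (p ++ [i]). rewrite <- !subtree_app. repeat split; auto.
      * intros k Hk Hkg j r E. apply (Hq k Hk Hkg).
        destruct r as [|m r _] using rev_ind.
        -- apply app_inj_tail in E as [-> _]. exists []; now rewrite app_nil_r.
        -- rewrite app_comm_cons, app_assoc in E. apply app_inj_tail in E as [-> _].
           now exists (j :: r).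
      * eapply wf_child_defined; eauto. unfold subtree in H1; now rewrite app_nil_r in H1.
Qed.

End Chain.

Section Dovetailing.
Local Notation step := (@step F V ar).
Context (R : @rules F V) (trs_R : is_trs ar R).
Context (linear_R : left_linear R) (finite_R : left_finite R).

(** * The final term as one more term of the reduction *)

Definition top_lt (al : wordinal) (a b : option al) : Prop :=
  match a, b with
  | Some x, Some y => olt x y
  | Some _, None => True
  | None, _ => False
  end.

(** With the final term placed at a new top index, closed and open reductions are treated alike: the
    top is a successor in the first case and a limit in the second. *)
Definition add_top (al : wordinal) : wordinal.
Proof.
  refine (WOrdinal (option al) (top_lt al) _ _ _).
  - intros [a|] [b|] [c|]; simpl; try tauto. apply olt_trans.
  - intros [a|] [b|]; simpl; try tauto.
    destruct (olt_total al a b) as [|[->|]]; auto.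
  - assert (HS : forall a, Acc (top_lt al) (Some a)).
    { intro a; induction (olt_wf al a) as [a _ IH]. constructor. intros [b|]; simpl; auto; tauto. }
    intros [a|]; auto. constructor. intros [b|]; simpl; auto; tauto.
Defined.

Lemma is_glb_ext (S S' : tree -> Prop) m :
  (forall u, S u <-> S' u) -> is_glb ar S m -> is_glb ar S' m.
Proof.
  intros H (H1 & H2 & H3); split; [auto|split].
  - intros u Hu; apply H2, H, Hu.
  - intros m' Hm' Hle; apply H3; auto. intros u Hu; apply Hle, H, Hu.
Qed.

Lemma is_lub_ext (S S' : tree -> Prop) m :
  (forall u, S u <-> S' u) -> is_lub ar S m -> is_lub ar S' m.
Proof.
  intros H (H1 & H2 & H3); split; [auto|split].
  - intros u Hu; apply H2, H, Hu.
  - intros m' Hm' Hle; apply H3; auto. intros u Hu; apply Hle, H, Hu.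
Qed.

Lemma liminf_add_top (al : wordinal) (below : al -> Prop) (below' : add_top al -> Prop)
    (c : al -> tree) (c' : add_top al -> tree) t :
  (forall i, below' (Some i) <-> below i) -> ~ below' None ->
  (forall i, c' (Some i) = c i) ->
  is_liminf ar below c t -> is_liminf ar below' c' t.
Proof.
  intros Hb HN Hc (g & Hg & Ht).
  exists (fun b => match b with Some i => g i | None => t end). split.
  - intros [b|] Hbb; [|tauto]. apply Hb in Hbb. apply (is_glb_ext _ _ _) with (2 := Hg b Hbb).
    intro u; split.
    + intros (i & Hi & Hib & ->). exists (Some i). rewrite Hc, Hb. auto.
    + intros ([i|] & Hi & Hib & ->); [|tauto]. exists i. rewrite <- Hc, <- Hb. auto.
  - apply (is_lub_ext _ _ _) with (2 := Ht). intro u; split.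
    + intros (b & Hbb & ->). exists (Some b). rewrite Hb. auto.
    + intros ([b|] & Hbb & ->); [|tauto]. exists b. rewrite <- Hb. auto.
Qed.

Lemma spconv_reach (al : wordinal) s t : spconv ar R al s t -> reach R s t.
Proof.
  intros (T & P & Twf & Hwt & Hleast & Hempty & Hsucc & Hmax & Hlim & Hopen).
  destruct (classic (inhabited al)) as [[a]|Hne].
  2:{ rewrite <- (teq_eq t s) by (apply Hempty; intro a; now apply Hne).
      now apply reach_refl. }
  destruct (least_witness al (fun _ => True)) as (z & _ & Hz); [eauto|].
  rewrite <- (teq_eq (T z) s) by (apply Hleast; intros k Hk; now apply (Hz k)).
  set (T' := fun i : add_top al => match i with Some i => T i | None => t end).
  set (P' := fun i : add_top al => match i with Some i => P i | None => [] end).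
  assert (Twf' : forall i, wf (T' i)) by (intros [i|]; simpl; auto).
  (* Transport runs from the least index to the top at the root position, strictly above which no
     step can take place. *)
  apply (reach_transport R trs_R linear_R finite_R (add_top al) T' P' Twf') with
    (g := None) (b := Some z) (p := []); simpl; auto.
  - intros [i|] [k|] [H1 H2]; simpl in *; try tauto.
    + apply Hsucc. split; auto. intros m. apply (H2 (Some m)).
    + apply Hmax. intros m Hm. apply (H2 (Some m)); auto.
  - intros [l|] [(k & Hk) Hn].
    + apply (liminf_add_top al (fun i => olt i l) _ (fun i => cxt (T i) (P i)));
        simpl; try tauto.
      apply Hlim. split.
      * destruct k as [k|]; simpl in Hk; [eauto|tauto].
      * intros (m & Hm1 & Hm2). apply Hn. exists (Some m). split; auto.
        intros [w|]; simpl; [apply Hm2|tauto].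
    + apply (liminf_add_top al (fun _ => True) _ (fun i => cxt (T i) (P i)));
        simpl; try tauto.
      apply Hopen; [now constructor|]. intro i. apply NNPP; intro H. apply Hn.
      exists (Some i). split; simpl; auto. intros [m|]; simpl; [|tauto].
      intros [Him _]; eauto.
  - intros [i|] _ _ j r E; [|discriminate]. destruct (P' (Some i)); discriminate.
  - apply Twf.
  - apply reach_refl. apply Twf.
Qed.

(** * Dovetailing *)

(** Invariant of the dovetailing: the first [n] layers of [t] are already present in [s], up to
    active subterms at [Bot], and [reach] promises the rest. *)
Fixpoint upto (n : nat) (s t : tree) : Prop :=
  match n with
  | 0 => reach R s t
  | S n => match t [] with
           | Some (Fun f) => s [] = Some (Fun f) /\
               forall i, i < ar f -> upto n (subtree s [i]) (subtree t [i])
           | Some (Var x) => s [] = Some (Var x)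
           | _ => active R s
           end
  end.

(** The positions that stage [n] may contract without destroying a settled label. *)
Definition allowed (n : nat) (t : tree) (p : pos) : Prop :=
  forall q l, t q = Some l -> l <> Bot -> length q < n -> ~ prefix p q.

Definition progress (n : nat) (t s : tree) (L : list pos) : Prop :=
  forall q, t q = Some Bot -> length q <= n -> s q = Some Bot \/ In q L.

Lemma upto_label n : forall s t q l,
  wf t -> upto n s t -> t q = Some l -> l <> Bot -> length q < n -> s q = Some l.
Proof.
  induction n as [|n IH]; intros s t q l Ht Hup Hq Hl Hn; [lia|]. simpl in Hup.
  destruct q as [|i q].
  - rewrite Hq in Hup. destruct l as [f|x|]; tauto.
  - destruct (wf_inner t [] i q Ht) as (f & Hf & Hi); [simpl; congruence|].
    rewrite Hf in Hup. destruct Hup as [_ Hup].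
    apply (IH (subtree s [i]) (subtree t [i]) q); auto; [|simpl in Hn; lia].
    eapply wf_child; eauto.
Qed.

(** Unfolding [reach] at depth [n] produces the next layer, and every [Bot] met on the way receives
    one unit of activity. The work in the children is joined by [red_children]. *)
Lemma upto_stage n : forall s t, wf s -> wf t -> upto n s t ->
  exists L s', red R s L s' /\ upto (S n) s' t /\
    (forall p, In p L -> allowed n t p) /\ progress n t s' L.
Proof.
  (* A target with root [Bot] is a single leaf, so the same activity serves at every depth and no
     proper label can be destroyed. *)
  assert (Hbot : forall n s t, wf t -> t [] = Some Bot -> upto n s t ->
    exists L s', red R s L s' /\ upto (S n) s' t /\
    (forall p, In p L -> allowed n t p) /\ progress n t s' L).
  { intros k s t Ht E Hup.
    assert (Ha : active R s).
    { destruct k; simpl in Hup; [apply reach_unfold in Hup; now apply Hup|now rewrite E in Hup]. }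
    assert (Hleaf : forall q, t q <> None -> q = []).
    { intros q Hq. apply (wf_leaf t [] q Bot Ht E); auto; discriminate. }
    destruct (active_progress R s Ha) as (L & s' & Hr & Ha' & HL).
    exists L, s'. simpl; rewrite E. repeat split; auto.
    - intros p _ q l Hq Hl. rewrite (Hleaf q) in Hq; congruence.
    - intros q Hq _. rewrite (Hleaf q); auto. congruence. }
  induction n as [|n IH]; intros s t Hs Ht Hup;
    destruct (t []) as [[f|x|]|] eqn:E; auto; try (now destruct Ht).
  - apply reach_unfold in Hup as [_ _ _ _ H]. destruct (H f E) as (L & s' & H1 & H2 & H3).
    exists L, s'; simpl; rewrite E; repeat split; auto.
    + intros p _ q l _ _ Hq; lia.
    + intros [|i q] Hq Hn; [congruence|simpl in Hn; lia].
  - apply reach_unfold in Hup as [_ _ _ H _]. destruct (H x E) as (L & s' & H1 & H2).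
    exists L, s'; simpl; rewrite E; repeat split; auto.
    + intros p _ q l _ _ Hq; lia.
    + intros [|i q] Hq Hn; [congruence|simpl in Hn; lia].
  - cbn [upto] in Hup. rewrite E in Hup. destruct Hup as [Hsf Hup].
    destruct (red_children R (fun i L u => upto (S n) u (subtree t [i]) /\
        (forall p, In p L -> allowed n (subtree t [i]) p) /\
        progress n (subtree t [i]) u L) s f) as (L & s' & Hr & Hf' & HL & Hch); auto.
    { intros i Hi. apply IH; auto; eapply wf_child; eauto. }
    exists L, s'. split; [auto|]. split; [|split].
    + remember (S n) as m. cbn [upto]. rewrite E. split; auto.
      intros i Hi. now destruct (Hch i Hi) as (L' & [H _] & _).
    + intros p Hp [|i q] l Hq Hl Hn [r Hr'].
      * destruct (HL p Hp) as (i & p' & -> & _). discriminate.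
      * destruct (HL p Hp) as (j & p' & -> & Hj). injection Hr' as <- ->.
        destruct (Hch i Hj) as (L' & (_ & H & _) & HL'). apply HL' in Hp.
        apply (H p' Hp (p' ++ r) l); auto; [|exists r; auto]. simpl in Hn; lia.
    + intros [|i q] Hq Hn; [congruence|].
      destruct (wf_inner t [] i q Ht) as (g & Hg & Hi); [simpl; congruence|].
      replace g with f in Hi by congruence.
      destruct (Hch i Hi) as (L' & (_ & _ & H) & HL'). rewrite <- HL'.
      apply (H q); auto. simpl in Hn; lia.
  - cbn [upto] in Hup. rewrite E in Hup.
    exists [], s. split; [constructor|]. split; [|split].
    + cbn [upto]; now rewrite E.
    + intros p [].
    + intros q Hq Hn. rewrite (wf_leaf t [] q _ Ht E) in Hq; try congruence.
      * simpl; congruence.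
Qed.

Lemma upto_limit n s t : wf s -> wf t -> (forall k, upto (n + k) s t) ->
  (forall q, t q = Some Bot -> s q = Some Bot) -> s = t.
Proof.
  intros Hs Ht Hup Hbot. apply teq_eq; intro q.
  assert (Hlab : forall q l, t q = Some l -> s q = Some l).
  { intros p l Hp. destruct (classic (l = Bot)) as [->|Hl]; auto.
    apply (upto_label (n + S (length p)) s t); auto; lia. }
  induction q as [|i q IH] using rev_ind.
  - destruct (t []) eqn:E; auto. now destruct Ht.
  - destruct (t (q ++ [i])) eqn:E; auto.
    apply NNPP; intro H. apply wf_iff in Hs as [_ Hs]. apply Hs in H.
    rewrite IH in H. apply wf_iff in Ht as [_ Ht]. now apply Ht in H.
Qed.

(** Stages without steps are skipped. They cannot continue forever: [s] would then satisfy the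
    invariant at all depths and have [Bot] wherever [t] does, hence equal [t]. *)
Lemma upto_proper_stage n s t : wf s -> wf t -> upto n s t -> s <> t ->
  exists m L s', n < m /\ L <> [] /\ red R s L s' /\ upto m s' t /\
    (forall p, In p L -> allowed n t p) /\ progress n t s' L.
Proof.
  intros Hs Ht Hup Hne. apply NNPP; intro Hno.
  assert (Hempty : forall k, upto (n + k) s t -> upto (n + S k) s t /\ progress (n + k) t s []).
  { intros k Hk. destruct (upto_stage _ s t Hs Ht Hk) as (L & s' & Hr & Hup' & Ha & Hp).
    destruct L as [|p L].
    - inversion Hr; subst. rewrite Nat.add_succ_r; auto.
    - destruct Hno. exists (S (n + k)), (p :: L), s'. repeat split; auto; try lia; try discriminate.
      + intros q Hq w l Hw Hl Hn. apply (Ha q Hq w l); auto; lia.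
      + intros q Hq Hn; apply Hp; auto; lia. }
  assert (Hall : forall k, upto (n + k) s t).
  { induction k as [|k IH]; [now rewrite Nat.add_0_r|now apply Hempty]. }
  apply Hne, (upto_limit n); auto. intros q Hq.
  destruct (Hempty (length q) (Hall _)) as [_ Hp]. destruct (Hp q Hq); [lia|auto|].
  simpl in *; tauto.
Qed.

(** * Reductions indexed by natural numbers *)

Lemma red_sequence s L t : red R s L t ->
  exists U : nat -> tree, U 0 = s /\ U (length L) = t /\
    forall k, k < length L -> step R (U k) (nth k L []) (U (S k)).
Proof.
  induction 1 as [s|s p s' L t Hst Hr (U & H0 & Ht & HU)].
  - exists (fun _ => s). simpl; repeat split; auto; lia.
  - exists (fun k => match k with 0 => s | S k => U k end). simpl; repeat split; auto.
    intros [|k] Hk; [now rewrite H0|]. apply HU; lia.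
Qed.

(** Taking for [D] an initial segment of the naturals covers finite lengths and omega at once. *)
Definition initial_ordinal (D : nat -> Prop) : wordinal.
Proof.
  refine (WOrdinal {i | D i} (fun a b => proj1_sig a < proj1_sig b) _ _ _).
  - intros a b c; apply Nat.lt_trans.
  - intros [a Ha] [b Hb]; simpl. destruct (Nat.lt_total a b) as [|[->|]]; auto.
    rewrite (proof_irrelevance _ Ha Hb); auto.
  - apply (well_founded_ltof _ (fun a : {i | D i} => proj1_sig a)).
Defined.

Lemma initial_ordinal_le_omega D :
  (forall i j, i < j -> D j -> D i) -> le_omega (initial_ordinal D).
Proof.
  intro HD. exists (fun a : initial_ordinal D => proj1_sig a). split.
  - intros a b; reflexivity.
  - intros [a Ha] n Hn; simpl in *. exists (exist _ n (HD n a Hn Ha)); auto.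
Qed.

(** No limit index occurs inside such a reduction, so the only limit inferior to verify is the final
    one when [D] holds everywhere; the last two hypotheses state it pointwise. *)
Lemma sequence_spconv (D : nat -> Prop) (T : nat -> tree) (P : nat -> pos) s t :
  (forall i j, i < j -> D j -> D i) ->
  wf s -> wf t -> T 0 = s ->
  (forall i, D i -> step R (T i) (P i) (T (S i))) ->
  (forall i, D i -> ~ D (S i) -> T (S i) = t) ->
  (~ D 0 -> t = s) ->
  ((forall i, D i) -> forall p l, t p = Some l -> l <> Bot ->
     exists b, forall k, b <= k -> cxt (T k) (P k) p = Some l) ->
  ((forall i, D i) -> forall p l b, t p = Some Bot -> l <> Bot ->
     exists k, b <= k /\ cxt (T k) (P k) p <> Some l) ->
  spconv ar R (initial_ordinal D) s t.
Proof.
  intros HD Hs Ht H0 Hst Hlast Hempty Hev Hbot.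
  assert (Twf : forall i, D i -> wf (T i)).
  { induction i as [|i IH]; intro Hi; [now rewrite H0|].
    assert (D i) by (apply (HD i (S i)); auto). eapply step_wf; eauto. }
  assert (Hsucc : forall i k : initial_ordinal D, is_succ i k -> proj1_sig k = S (proj1_sig i)).
  { intros [i Hi] [k Hk] [H1 H2]; simpl in *.
    destruct (Nat.eq_dec k (S i)) as [|Hne]; auto. exfalso.
    assert (Hi' : D (S i)) by (apply (HD (S i) k); auto; lia).
    apply (H2 (exist _ (S i) Hi')); simpl; lia. }
  exists (fun i : initial_ordinal D => T (proj1_sig i)), (fun i => P (proj1_sig i)).
  split; [|split; [|split; [|split; [|split; [|split; [|split]]]]]]; auto.
  - intros [i Hi]; simpl; auto.
  - intros [[|i] Hi] Hl; simpl; [rewrite H0; intro; reflexivity|].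
    exfalso. assert (Hi' : D i) by (apply (HD i (S i)); auto).
    apply (Hl (exist _ i Hi')); simpl; lia.
  - intro He. rewrite Hempty; [intro; reflexivity|]. intro H; apply He; now exists 0.
  - intros i k Hik. rewrite (Hsucc i k Hik). apply Hst, (proj2_sig i).
  - intros [i Hi] Hmax; simpl. rewrite <- (Hlast i); auto.
    intro HS. apply (Hmax (exist _ (S i) HS)); simpl; lia.
  - intros [[|i] Hi] [(k & Hk) Hn]; simpl in Hk; [lia|]. exfalso; apply Hn.
    assert (Hi' : D i) by (apply (HD i (S i)); auto).
    exists (exist _ i Hi'). split; simpl; [lia|]. intros m; lia.
  - intros [[a Ha]] Hopen.
    assert (Hall : forall i, D i).
    { induction i as [|i IH].
      - destruct a; auto. apply (HD 0 (S a)); auto; lia.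
      - destruct (Hopen (exist _ i IH)) as ([k Hk] & Hlt); simpl in Hlt.
        destruct (Nat.eq_dec k (S i)) as [->|]; auto. apply (HD (S i) k); auto; lia. }
    apply liminf_intro; auto.
    + now exists (exist _ a Ha).
    + intros p l Hp Hl. destruct (Hev Hall p l Hp Hl) as [b Hb].
      exists (exist _ b (Hall b)); split; auto. apply agree_tail; split; auto.
      intros [k Hk] _ Hkb; simpl in *. apply Hb; lia.
    + intros p l [b Hb] Hp _ Hag. apply agree_tail in Hag as [Hl Hag].
      destruct (Hbot Hall p l b Hp Hl) as (k & Hk & Hne).
      apply Hne. apply (Hag (exist _ k (Hall k))); simpl; auto; lia.
Qed.

Lemma reach_spconv s t : reach R s t ->
  exists be : wordinal, le_omega be /\ spconv ar R be s t.
Proof.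
  intro Hre. assert (Hw : wf s /\ wf t) by (now apply reach_unfold in Hre as []).
  destruct Hw as [Hs Ht].
  (* If no finite reduction ends in [t], every term reached from [s] differs from [t], so proper
     stages can be appended forever. *)
  destruct (classic (exists L, red R s L t)) as [[L HL]|Hinf].
  { destruct (red_sequence s L t HL) as (U & H0 & Hlen & HU).
    assert (HD : forall i j, i < j -> j < length L -> i < length L) by (intros; lia).
    exists (initial_ordinal (fun i => i < length L)). split.
    - now apply initial_ordinal_le_omega.
    - apply (sequence_spconv _ U (fun k => nth k L [])); auto.
      + intros i H1 H2. now replace (S i) with (length L) by lia.
      + intro H. now replace (length L) with 0 in Hlen by lia; congruence.
      + intro H; specialize (H (length L)); lia.
      + intro H; specialize (H (length L)); lia. }
  set (St := {x : nat * tree | wf (snd x) /\ upto (fst x) (snd x) t /\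
                               exists L, red R s L (snd x)}).
  assert (Hnext : forall x : St, exists y : list pos * St,
    let n := fst (proj1_sig x) in let u := snd (proj1_sig x) in
    let m := fst (proj1_sig (snd y)) in let v := snd (proj1_sig (snd y)) in
    n < m /\ fst y <> [] /\ red R u (fst y) v /\
    (forall p, In p (fst y) -> allowed n t p) /\ progress n t v (fst y)).
  { intros [[n u] (Hu & Hup & L & HL)]; simpl in *.
    destruct (upto_proper_stage n u t) as (m & M & v & H1 & H2 & H3 & H4 & H5 & H6); auto.
    { intros ->; eauto. }
    assert (Hv : wf v /\ upto m v t /\ exists L, red R s L v).
    { split; [eapply red_wf; eauto|split; [auto|eauto using red_app]]. }
    now exists (M, exist _ (m, v) Hv). }
  apply choice in Hnext as [next Hnext].
  assert (Hx0 : wf s /\ upto 0 s t /\ exists L, red R s L s).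
  { split; [auto|split; [auto|exists []; constructor]]. }
  set (x := fix x (j : nat) : St :=
    match j with 0 => exist _ (0, s) Hx0 | S j => snd (next (x j)) end).
  set (N := fun j => fst (proj1_sig (x j))).
  set (S' := fun j => snd (proj1_sig (x j))).
  set (L := fun j => fst (next (x j))).
  assert (HN : forall j, j <= N j).
  { induction j as [|j IH]; [lia|]. destruct (Hnext (x j)) as (H & _).
    change (N j < N (S j)) in H. lia. }
  assert (HLne : forall j, 0 < length (L j)).
  { intro j. destruct (Hnext (x j)) as (_ & H & _). fold (L j) in H.
    destruct (L j); simpl; [tauto|lia]. }
  assert (HLred : forall j, red R (S' j) (L j) (S' (S j))).
  { intro j. now destruct (Hnext (x j)) as (_ & _ & H & _). }
  assert (HLall : forall j p, In p (L j) -> allowed (N j) t p).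
  { intro j. now destruct (Hnext (x j)) as (_ & _ & _ & H & _). }
  assert (HLpr : forall j, progress (N j) t (S' (S j)) (L j)).
  { intro j. now destruct (Hnext (x j)) as (_ & _ & _ & _ & H). }
  assert (HS' : forall j, upto (N j) (S' j) t) by (intro j; apply (proj2_sig (x j))).
  assert (HU : forall j, exists U : nat -> tree, U 0 = S' j /\ U (length (L j)) = S' (S j) /\
    forall k, k < length (L j) -> step R (U k) (nth k (L j) []) (U (S k))).
  { intro j; apply red_sequence; auto. }
  assert (HS0 : S' 0 = s) by reflexivity.
  clearbody N S' L. clear x Hx0 Hnext next.
  apply choice in HU as [U HU].
  (* Concatenates the non-empty stages: [ix k] gives the stage and the offset within it of the
     [k]-th step overall. *)
  set (ix := fix ix (k : nat) : nat * nat :=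
    match k with
    | 0 => (0, 0)
    | S k => if S (snd (ix k)) <? length (L (fst (ix k)))
             then (fst (ix k), S (snd (ix k))) else (S (fst (ix k)), 0)
    end).
  assert (Hix : forall k, snd (ix k) < length (L (fst (ix k)))).
  { induction k as [|k IH]; simpl; auto.
    destruct (Nat.ltb_spec (S (snd (ix k))) (length (L (fst (ix k))))); simpl; auto. }
  assert (Hmono : forall k d, fst (ix k) <= fst (ix (d + k))).
  { intros k; induction d as [|d IH]; simpl; auto. destruct Nat.ltb; simpl; lia. }
  assert (Hhit : forall j i, i < length (L j) -> exists k, ix k = (j, i)).
  { assert (Hrow : forall j k, ix k = (j, 0) -> forall i, i < length (L j) -> ix (i + k) = (j, i)).
    { intros j k Hk; induction i as [|i IH]; intro Hi; simpl; auto.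
      rewrite IH by lia. simpl. destruct (Nat.ltb_spec (S i) (length (L j))); auto; lia. }
    assert (Hcol : forall j, exists k, ix k = (j, 0)).
    { induction j as [|j [k Hk]]; [now exists 0|].
      exists (S (length (L j) - 1 + k)). simpl. specialize (HLne j).
      rewrite (Hrow j k Hk) by lia. simpl.
      destruct (Nat.ltb_spec (S (length (L j) - 1)) (length (L j))); auto; lia. }
    intros j i Hi. destruct (Hcol j) as [k Hk]. exists (i + k); auto. }
  assert (Hlate : forall k b, fst (ix b) < fst (ix k) -> b <= k).
  { intros k b H. destruct (Nat.le_gt_cases b k) as [|Hlt]; auto.
    specialize (Hmono k (b - k)). replace (b - k + k) with b in Hmono by lia. lia. }
  set (T := fun k => U (fst (ix k)) (snd (ix k))).
  set (P := fun k => nth (snd (ix k)) (L (fst (ix k))) []).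
  assert (HT : forall k, step R (T k) (P k) (T (S k))).
  { intro k. unfold T, P. simpl. specialize (Hix k).
    destruct (ix k) as [j i]; simpl in *. destruct (HU j) as (_ & H1 & H2).
    destruct (Nat.ltb_spec (S i) (length (L j))) as [H|H]; simpl; auto.
    (* The last step of stage [j] ends in the first term of stage [S j]. *)
    replace (U (S j) 0) with (U j (S i)); auto.
    destruct (HU (S j)) as (-> & _). rewrite <- H1. f_equal; lia. }
  assert (HT0 : forall k j, ix k = (j, 0) -> T k = S' j).
  { intros k j E. unfold T; rewrite E; simpl. now destruct (HU j). }
  exists (initial_ordinal (fun _ => True)). split; [now apply initial_ordinal_le_omega|].
  apply (sequence_spconv _ T P); auto; try tauto.
  - rewrite (HT0 0 0); auto.
  (* From stage [S (length p)] on, the label at [p] is settled and no step is at or above [p], so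
     the contexts keep it too. *)
  - intros _ p l Hp Hl. destruct (Hhit (S (length p)) 0 (HLne _)) as [k0 Hk0].
    assert (Hstage : forall d, length p < N (fst (ix (d + k0)))).
    { intro d. specialize (Hmono k0 d). rewrite Hk0 in Hmono. simpl in Hmono.
      specialize (HN (fst (ix (d + k0)))). lia. }
    assert (Hout : forall d, ~ prefix (P (d + k0)) p).
    { intro d. apply (HLall _ _ (nth_In _ _ (Hix (d + k0))) p l); auto. }
    assert (Hlab : forall d, T (d + k0) p = Some l).
    { induction d as [|d IH].
      - change (0 + k0) with k0. rewrite (HT0 k0 _ Hk0). apply (upto_label (N (S (length p))) _ t); auto.
      - simpl. rewrite (step_outside R _ _ _ p (HT (d + k0))); auto. }
    exists k0. intros k Hk. replace k with ((k - k0) + k0) by lia. rewrite cxt_out; auto.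
  (* The stage [j] is deep enough for [progress] to cover [p] and lies beyond the stage of [b].
     Either the next stage starts with [Bot] at [p], or a step of stage [j] at [p] puts [Bot] into
     its context. *)
  - intros _ p l b Hp Hl. set (j := length p + S (fst (ix b))).
    destruct (HLpr j p Hp) as [Hb|Hin]; [specialize (HN j); lia| |].
    + destruct (Hhit (S j) 0 (HLne _)) as [k Hk]. exists k. split.
      * apply Hlate. rewrite Hk; simpl; lia.
      * intro Hc. apply cxt_lab in Hc as [_ Hc]; auto. rewrite (HT0 k _ Hk) in Hc. congruence.
    + apply (In_nth _ _ []) in Hin as (i & Hi & Hnth).
      destruct (Hhit j i Hi) as [k Hk]. exists k. split.
      * apply Hlate. rewrite Hk; simpl; lia.
      * replace (P k) with p; [rewrite cxt_at; congruence|].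
        unfold P; rewrite Hk; auto.
Qed.
End Dovetailing.

End Compression.

Theorem theorem6p15 (F V : Type) (ar : F -> nat) (R : @rules F V) :
  is_trs ar R -> orthogonal ar R -> left_finite R ->
  forall (s t : @tree F V) (al : wordinal),
    spconv ar R al s t ->
    exists be : wordinal, le_omega be /\ spconv ar R be s t.
Proof.
  intros Htrs [Hlin _] Hfin s t al H.
  apply (reach_spconv ar R Htrs). exact (spconv_reach ar R Htrs Hlin Hfin al s t H).
Qed.
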